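(* Let $f,g,\varphi,L_f,\gamma_g,T_\gamma$ and the criticality threshold $\Gamma$ be as in the context, and let $\bar\gamma:=\min\{\gamma_g,1/L_f\}$. Then: (i) (criticality $\Rightarrow$ stationarity) for every $\gamma\in(0,\gamma_g)$, $\operatorname{fix}T_\gamma\subseteq\operatorname{zer}\hat\partial\varphi$, i.e. every $x$ with $x\in T_\gamma(x)$ satisfies $0\in\hat\partial\varphi(x)$; (ii) (optimality $\Rightarrow$ criticality) $\Gamma(x^\star)\ge\bar\gamma$ for all $x^\star\in\operatorname{argmin}\varphi$; in particular, $\operatorname{argmin}\varphi\subseteq\operatorname{fix}T_\gamma$ for all $\gamma\in(0,\bar\gamma)$, and also for $\gamma=1/L_f$ if $\gamma_g>1/L_f$.
   Context: Standing assumptions: $f:\mathbb{R}^n\to\mathbb{R}$ is differentiable with Lipschitz continuous gradient, $L_f$ denoting the Lipschitz modulus of $\nabla f$ (with $1/L_f=+\infty$ if $L_f=0$); $g:\mathbb{R}^n\to\mathbb{R}\cup\{+\infty\}$ is proper, lower semicontinuous and prox-bounded, meaning that $g+\frac{1}{2\gamma}\|\cdot\|^2$ is bounded below for some $\gamma>0$; $\gamma_g\in(0,+\infty]$ is the supremum of all such $\gamma$; $\varphi:=f+g$ and $\operatorname{argmin}\varphi\neq\emptyset$. Neither function need be convex. For $\gamma>0$, $\operatorname{prox}_{\gamma g}(x):=\operatorname{argmin}_z\{g(z)+\frac{1}{2\gamma}\|z-x\|^2\}$, and the (set-valued) forward-backward operator is $T_\gamma(x):=\operatorname{prox}_{\gamma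 g}(x-\gamma\nabla f(x))=\operatorname{argmin}_z\{f(x)+\langle\nabla f(x),z-x\rangle+\frac{1}{2\gamma}\|z-x\|^2+g(z)\}$; $\operatorname{fix}T_\gamma:=\{x: x\in T_\gamma(x)\}$. The criticality threshold is $\Gamma(x):=\sup\bigl(\{\gamma>0: x\in T_\gamma(x)\}\cup\{0\}\bigr)\in[0,\gamma_g]$. $\hat\partial\varphi(x)$ is the regular (Fréchet) subdifferential: $v\in\hat\partial\varphi(x)$ (for $\varphi(x)<\infty$) iff $\varphi(z)\ge\varphi(x)+\langle v,z-x\rangle+o(\|z-x\|)$. *)

(* Defs.v *)
From mathcomp Require Import all_boot all_order all_algebra.
From mathcomp Require Import all_classical all_reals all_analysis.

Set Implicit Arguments.
Unset Strict Implicit.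
Unset Printing Implicit Defensive.

Import Order.TTheory GRing.Theory Num.Theory.
Import numFieldNormedType.Exports.

Local Open Scope classical_set_scope.
Local Open Scope ring_scope.

Definition dotv (R : realType) (n : nat) (u v : 'rV[R]_n) : R :=
  \sum_(i < n) u ord0 i * v ord0 i.

(* The canonical norm of ['rV[R]_n] is the sup norm.  It induces the same
   topology and the same differentials as the Euclidean one, but not the same
   Lipschitz moduli or proximal mappings. *)
Definition enorm (R : realType) (n : nat) (u : 'rV[R]_n) : R :=
  Num.sqrt (dotv u u).

(* Meaningful where [f] is differentiable. *)
Definition grad (R : realType) (n : nat) (f : 'rV[R]_n -> R) (x : 'rV[R]_n) :
  'rV[R]_n := \row_(j < n) 'd f x (delta_mx ord0 j).

Definition lipschitz_constants (R : realType) (n m : nat)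
  (F : 'rV[R]_n -> 'rV[R]_m) : set R :=
  [set L | 0 <= L /\ forall x y, enorm (F x - F y) <= L * enorm (x - y)].

(* Meaningful when [lipschitz_constants F !=set0]. *)
Definition lip_modulus (R : realType) (n m : nat)
  (F : 'rV[R]_n -> 'rV[R]_m) : R := inf (lipschitz_constants F).

Definition argmin (R : realType) (T : Type) (h : T -> \bar R) : set T :=
  [set x | forall z, (h x <= h z)%E].

Definition proper_fun (R : realType) (T : Type) (g : T -> \bar R) : Prop :=
  (forall x, (-oo < g x)%E) /\ exists x, (g x < +oo)%E.

Definition prox_params (R : realType) (n : nat) (g : 'rV[R]_n -> \bar R) :
  set R :=
  [set gamma | 0 < gamma /\ exists m : R, forall z,
    (m%:E <= g z + ((2 * gamma)^-1 * enorm z ^+ 2)%:E)%E].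

Definition prox_bounded (R : realType) (n : nat) (g : 'rV[R]_n -> \bar R) :
  Prop := prox_params g !=set0.

Definition prox_threshold (R : realType) (n : nat) (g : 'rV[R]_n -> \bar R) :
  \bar R := ereal_sup (EFin @` prox_params g).

Definition prox (R : realType) (n : nat) (gamma : R) (g : 'rV[R]_n -> \bar R)
  (x : 'rV[R]_n) : set 'rV[R]_n :=
  argmin (fun z => (g z + ((2 * gamma)^-1 * enorm (z - x) ^+ 2)%:E)%E).

Definition fb_op (R : realType) (n : nat) (f : 'rV[R]_n -> R)
  (g : 'rV[R]_n -> \bar R) (gamma : R) (x : 'rV[R]_n) : set 'rV[R]_n :=
  prox gamma g (x - gamma *: grad f x).

Definition fix_set (T : Type) (F : T -> set T) : set T := [set x | F x x].

Definition crit_threshold (R : realType) (n : nat) (f : 'rV[R]_n -> R)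
  (g : 'rV[R]_n -> \bar R) (x : 'rV[R]_n) : \bar R :=
  ereal_sup (EFin @`
    ([set gamma | 0 < gamma /\ fb_op f g gamma x x] `|` [set 0])).

(* Regular (Frechet) subdifferential; [r] is the o(||z - x||) term, which is
   taken with respect to the Euclidean norm. *)
Definition regular_subdiff (R : realType) (n : nat) (phi : 'rV[R]_n -> \bar R)
  (x : 'rV[R]_n) : set 'rV[R]_n :=
  [set v | phi x \is a fin_num /\
    exists2 r : 'rV[R]_n -> R, r =o_x (fun z => enorm (z - x)) &
      forall z, (phi x + (dotv v (z - x) + r z)%:E <= phi z)%E].

Definition zer (R : realType) (n : nat)
  (S : 'rV[R]_n -> set 'rV[R]_n) : set 'rV[R]_n := [set x | S x 0].

(* Main.v *)
Require Import Defs.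
From mathcomp Require Import all_boot all_order all_algebra.
From mathcomp Require Import all_classical all_reals all_analysis.
From mathcomp Require Import ring lra.

(* Completing the square, [x \in T_gamma(x)] says that
   [g x <= g z + <grad f x, z - x> + |z - x|^2 / (2 gamma)] for all [z].  The
   descent lemma bounds [f z - f x - <grad f x, z - x>] above by
   [L / 2 * |z - x|^2], so minimality of [x] for [f + g] yields this inequality
   as soon as [gamma * L <= 1].  For stationarity, adding the inequality to a
   quadratic lower bound of [f] gives [phi z >= phi x - C |z - x|^2], hence [0]
   is a regular subgradient of [phi] at [x]. *)

Import Order.TTheory GRing.Theory Num.Theory.
Import numFieldNormedType.Exports.

Local Open Scope classical_set_scope.
Local Open Scope ring_scope.

(** * Euclidean inner product and norm *)

Lemma dotvC (R : realType) (n : nat) (u v : 'rV[R]_n) : dotv u v = dotv v u.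
Proof. by apply: eq_bigr => i _; rewrite mulrC. Qed.

Lemma dotvDl (R : realType) (n : nat) (u v w : 'rV[R]_n) :
  dotv (u + v) w = dotv u w + dotv v w.
Proof. by rewrite -big_split; apply: eq_bigr => i _; rewrite mxE mulrDl. Qed.

Lemma dotvZl (R : realType) (n : nat) (a : R) (u w : 'rV[R]_n) :
  dotv (a *: u) w = a * dotv u w.
Proof. by rewrite mulr_sumr; apply: eq_bigr => i _; rewrite mxE mulrA. Qed.

Lemma dotvNl (R : realType) (n : nat) (u w : 'rV[R]_n) :
  dotv (- u) w = - dotv u w.
Proof. by rewrite -scaleN1r dotvZl mulN1r. Qed.

Lemma dotvDr (R : realType) (n : nat) (u v w : 'rV[R]_n) :
  dotv w (u + v) = dotv w u + dotv w v.
Proof. by rewrite !(dotvC _ _ w) dotvDl. Qed.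

Lemma dotvZr (R : realType) (n : nat) (a : R) (u w : 'rV[R]_n) :
  dotv w (a *: u) = a * dotv w u.
Proof. by rewrite !(dotvC _ _ w) dotvZl. Qed.

Lemma dotvNr (R : realType) (n : nat) (u w : 'rV[R]_n) :
  dotv w (- u) = - dotv w u.
Proof. by rewrite !(dotvC _ _ w) dotvNl. Qed.

Lemma dotv0l (R : realType) (n : nat) (u : 'rV[R]_n) : dotv 0 u = 0.
Proof. by apply: big1 => i _; rewrite mxE mul0r. Qed.

Lemma dotv0r (R : realType) (n : nat) (u : 'rV[R]_n) : dotv u 0 = 0.
Proof. by rewrite (dotvC _ _ u) dotv0l. Qed.

Lemma dotvv_ge0 (R : realType) (n : nat) (u : 'rV[R]_n) : 0 <= dotv u u.
Proof. by apply: sumr_ge0 => i _; rewrite -expr2 sqr_ge0. Qed.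

Lemma dotvv (R : realType) (n : nat) (u : 'rV[R]_n) : dotv u u = enorm u ^+ 2.
Proof. by rewrite sqr_sqrtr // dotvv_ge0. Qed.

Lemma enorm_ge0 (R : realType) (n : nat) (u : 'rV[R]_n) : 0 <= enorm u.
Proof. exact: sqrtr_ge0. Qed.

Lemma enorm0 (R : realType) (n : nat) : enorm (0 : 'rV[R]_n) = 0.
Proof. by rewrite /enorm dotv0l sqrtr0. Qed.

Lemma enorm0_eq0 (R : realType) (n : nat) (u : 'rV[R]_n) : enorm u = 0 -> u = 0.
Proof.
move=> u0; have /psumr_eq0P uu : dotv u u = 0 by rewrite dotvv u0 expr0n.
apply/rowP => i; rewrite mxE; apply/eqP.
by rewrite -sqrf_eq0 expr2 uu// => j _; rewrite -expr2 sqr_ge0.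
Qed.

Lemma enormZ (R : realType) (n : nat) (a : R) (u : 'rV[R]_n) :
  enorm (a *: u) = `|a| * enorm u.
Proof.
by rewrite /enorm dotvZl dotvZr mulrA -expr2 sqrtrM ?sqr_ge0// sqrtr_sqr.
Qed.

Lemma enormN (R : realType) (n : nat) (u : 'rV[R]_n) : enorm (- u) = enorm u.
Proof. by rewrite -scaleN1r enormZ normrN1 mul1r. Qed.

Lemma enormD_sqr (R : realType) (n : nat) (u v : 'rV[R]_n) :
  enorm (u + v) ^+ 2 = enorm u ^+ 2 + 2 * dotv u v + enorm v ^+ 2.
Proof. rewrite -!dotvv dotvDl !dotvDr (dotvC _ _ v u); ring. Qed.

(** Cauchy-Schwarz: for nonzero [u] and [v], expand the square of the norm of
    [enorm v *: u - enorm u *: v] and divide by the product of the norms. *)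
Lemma dotv_le (R : realType) (n : nat) (u v : 'rV[R]_n) :
  dotv u v <= enorm u * enorm v.
Proof.
have [/enorm0_eq0 ->|u0] := eqVneq (enorm u) 0.
  by rewrite dotv0l mulr_ge0 ?enorm_ge0.
have [/enorm0_eq0 ->|v0] := eqVneq (enorm v) 0.
  by rewrite dotv0r mulr_ge0 ?enorm_ge0.
have uv : 0 < enorm u * enorm v by rewrite mulr_gt0 // lt0r enorm_ge0 andbT.
have := sqr_ge0 (enorm (enorm v *: u + (- enorm u) *: v)).
rewrite enormD_sqr !enormZ dotvZl dotvZr normrN !ger0_norm ?enorm_ge0// => h.
rewrite -subr_ge0 -(pmulr_rge0 _ uv); lra.
Qed.

Lemma enorm_continuous (R : realType) (n : nat) : continuous (@enorm R n).
Proof.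
move=> u; apply: (@continuous_comp _ _ _ (fun v => dotv v v) Num.sqrt).
  apply: continuous_big => [|i _ w]; first exact: add_continuous.
  by apply: continuousM; exact: coord_continuous.
exact: (@sqrt_continuous R).
Qed.

(** * Quadratic bounds from a Lipschitz gradient *)

Lemma diff_grad (R : realType) (n : nat) (f : 'rV[R]_n -> R) (x d : 'rV[R]_n) :
  differentiable f x -> 'd f x d = dotv (grad f x) d.
Proof.
move=> fx; rewrite [in LHS](row_sum_delta d) linear_sum.
by apply: eq_bigr => j _; rewrite linearZ mxE mulrC.
Qed.

Lemma is_derive_line (R : realType) (n : nat) (f : 'rV[R]_n -> R)
    (x d : 'rV[R]_n) (t : R) : differentiable f (x + t *: d) ->
  is_derive t 1 (fun s => f (x + s *: d)) (dotv (grad f (x + t *: d)) d).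
Proof.
move=> fxt.
have quotE : (fun h => h^-1 *: (((fun s => f (x + s *: d)) \o shift t)
      (h *: (1 : R)) - f (x + t *: d))) =
    (fun h => h^-1 *: ((f \o shift (x + t *: d)) (h *: d) - f (x + t *: d))).
  apply/funext => h /=; congr (_ *: (f _ - _)).
  by rewrite [h *: 1]mulr1 scalerDl addrCA.
split; first by rewrite /derivable quotE; exact: diff_derivable.
by rewrite /derive quotE -diff_grad// -deriveE.
Qed.

(** The mean value theorem replaces the usual integral: along the segment, subtract from [f] its
    linear part and the quadratic [K * s ^+ 2]. The resulting [h] has nonpositive slope on [0, 1],
    so [h 1 <= h 0]. *)
Lemma descent_le (R : realType) (n : nat) (f : 'rV[R]_n -> R) (L : R)
    (x d : 'rV[R]_n) :
  (forall y, differentiable f y) -> lipschitz_constants (grad f) L ->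
  f (x + d) <= f x + dotv (grad f x) d + L / 2 * enorm d ^+ 2.
Proof.
move=> f_diff [L0 lipL]; set c := dotv _ d.
pose K := L / 2 * enorm d ^+ 2.
pose h : R -> R := (fun s : R => f (x + s *: d)) - (c \*: (id : R -> R) +
  K \*: ((id : R -> R) * (id : R -> R))).
pose dh (t : R) : R := dotv (grad f (x + t *: d)) d - (c + 2 * t * K).
have hP (t : R) : is_derive t (1 : R) h (dh t).
  have fP := @is_derive_line _ _ f x d t (f_diff _).
  apply: is_derive_eq; rewrite /dh; congr (_ - _).
  rewrite /GRing.scale /=; ring.
have [|t] := @MVT_segment R h dh 0 1 ler01 (fun t _ => hP t).
  by apply: derivable_within_continuous => t _; have [] := hP t.
rewrite in_itv /= => /andP[t0 _] ht.
(* By Cauchy-Schwarz and the Lipschitz bound, the gradient increment contributes at most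
   [L * t * enorm d ^+ 2], which is [2 * t * K]. *)
have : dh t <= 0.
  have -> : dh t = dotv (grad f (x + t *: d) - grad f x) d - 2 * t * K.
    by rewrite /dh dotvDl dotvNl opprD addrA.
  rewrite subr_le0; apply: (le_trans (dotv_le _ _ _ _)).
  have := lipL (x + t *: d) x.
  rewrite (addrC x) addrK enormZ ger0_norm// => lipt.
  apply: (le_trans (ler_wpM2r (enorm_ge0 _ _ _) lipt)).
  by rewrite (_ : 2 * t * K = L * (t * enorm d) * enorm d)// /K; field.
have hE s : h s = f (x + s *: d) - (c * s + K * (s * s)) by [].
move: ht; rewrite !hE scale1r scale0r addr0; rewrite -/K; lra.
Qed.

(** Apply the upper bound from [x + d] back to [x], at cost [L / 2], then move the gradient from
    [x + d] to [x], at cost [L]. The total [3 / 2 * L] is not sharp, but stationarity only needs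
    some multiple of [enorm d ^+ 2]. *)
Lemma descent_ge (R : realType) (n : nat) (f : 'rV[R]_n -> R) (L : R)
    (x d : 'rV[R]_n) :
  (forall y, differentiable f y) -> lipschitz_constants (grad f) L ->
  f x + dotv (grad f x) d - 3 / 2 * L * enorm d ^+ 2 <= f (x + d).
Proof.
move=> f_diff lipL.
(* Stated on variables: on the concrete terms [lra] would unfold [grad]. *)
have combine (a b u v e : R) : a <= b - u + L / 2 * e ->
  - (u - v) <= L * e -> a + v - 3 / 2 * L * e <= b by lra.
have fx := descent_le _ _ _ _ (x + d) (- d) f_diff lipL.
rewrite addrK enormN dotvNr in fx.
have gradx : dotv (grad f (x + d) - grad f x) (- d) <= L * enorm d ^+ 2.
  apply: (le_trans (dotv_le _ _ _ _)).
  have [_ /(_ (x + d) x)] := lipL; rewrite (addrC x) addrK enormN => gradL.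
  by rewrite expr2 mulrA ler_wpM2r// enorm_ge0.
rewrite dotvNr dotvDl dotvNl in gradx.
exact: combine fx gradx.
Qed.

(** The infimum is attained: each difference quotient is a lower bound of the set of Lipschitz
    constants, hence at most its infimum. *)
Lemma lip_modulus_mem (R : realType) (n m : nat) (F : 'rV[R]_n -> 'rV[R]_m) :
  lipschitz_constants F !=set0 -> lipschitz_constants F (lip_modulus F).
Proof.
move=> [L0 F0]; split.
  by apply: lb_le_inf; [exists L0|move=> L []].
move=> x y; have [xy|xy] := eqVneq (enorm (x - y)) 0.
  by have [_ /(_ x y)] := F0; rewrite xy !mulr0.
have {}xy : 0 < enorm (x - y) by rewrite lt0r xy enorm_ge0.
rewrite -ler_pdivrMr//; apply: lb_le_inf; first by exists L0.
by move=> L [_ /(_ x y)]; rewrite ler_pdivrMr.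
Qed.

(* Completing the square turns the proximal objective into the forward-backward
   model of [f + g] at [x], up to an additive constant. *)
Lemma fb_opP (R : realType) (n : nat) (f : 'rV[R]_n -> R)
    (g : 'rV[R]_n -> \bar R) (gamma : R) (x y : 'rV[R]_n) : 0 < gamma ->
  fb_op f g gamma x y <-> argmin (fun z => (g z + (dotv (grad f x) (z - x) +
    (2 * gamma)^-1 * enorm (z - x) ^+ 2)%:E)%E) y.
Proof.
move=> gamma0; set k := gamma / 2 * enorm (grad f x) ^+ 2.
have E z : (2 * gamma)^-1 * enorm (z - (x - gamma *: grad f x)) ^+ 2 =
    dotv (grad f x) (z - x) + (2 * gamma)^-1 * enorm (z - x) ^+ 2 + k.
  rewrite opprB addrA (addrAC z) enormD_sqr enormZ dotvZr (dotvC _ _ (z - x)).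
  rewrite ger0_norm ?(ltW gamma0)// /k; field; lra.
by split => h z; have := h z; rewrite /= !E !EFinD !addeA leeD2rE.
Qed.

Lemma sqr_enorm_littleo (R : realType) (n : nat) (C : R) (x : 'rV[R]_n) :
  (fun z => C * enorm (z - x) ^+ 2) =o_x (fun z => enorm (z - x)).
Proof.
apply/eqoP => e e0.
have cont : {for x, continuous (fun z : 'rV[R]_n => `|C| * enorm (z - x))}.
  apply: continuousM; first exact: cst_continuous.
  apply: (@continuous_comp _ _ _ (fun z : 'rV[R]_n => z - x) (@enorm R n)).
    by apply: continuousB; [exact: cvg_id|exact: cst_continuous].
  exact: enorm_continuous.
have := cvgr_lt _ cont e; rewrite subrr enorm0 mulr0 => /(_ _ e0).
apply: filterS => z hz; rewrite normrM normrX expr2 mulrA.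
by rewrite ler_wpM2r// [`|enorm _|]ger0_norm ?enorm_ge0// ltW.
Qed.

Lemma proper_fin_num (R : realType) (T : Type) (g : T -> \bar R) (x : T) :
  proper_fun g -> (g x < +oo)%E -> g x \is a fin_num.
Proof. by move=> [g_gt _] gx; rewrite fin_numE -ltey gx gt_eqF. Qed.

(** Compare the minimizer with a point where [g] is finite. *)
Lemma argmin_fin_num (R : realType) (T : Type) (g : T -> \bar R) (h : T -> R)
    (x : T) :
  proper_fun g -> argmin (fun z => (g z + (h z)%:E)%E) x -> g x \is a fin_num.
Proof.
move=> g_proper xP; apply: proper_fin_num => //.
have [_ [x0 gx0]] := g_proper; have := xP x0.
rewrite /= -(fineK (proper_fin_num _ _ _ _ g_proper gx0)).
by case: (g x) => // r _; rewrite ltry.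
Qed.

(** * Criticality against stationarity and optimality *)

Lemma fix_fb_op_zer (R : realType) (n : nat) (f : 'rV[R]_n -> R)
    (g : 'rV[R]_n -> \bar R) (gamma : R) :
  (forall x, differentiable f x) -> lipschitz_constants (grad f) !=set0 ->
  proper_fun g -> 0 < gamma ->
  fix_set (fb_op f g gamma) `<=`
    zer (regular_subdiff (fun x => (f x)%:E + g x)%E).
Proof.
move=> f_diff [L lipL] g_proper gamma0 x /fb_opP -/(_ gamma0) xP.
have gx := argmin_fin_num _ _ _ _ _ g_proper xP.
split; first by rewrite fin_numD gx.
(* The coefficient adds the loss in [descent_ge] to the proximal weight; the gradient terms
   cancel. *)
exists (fun z => - (3 / 2 * L + (2 * gamma)^-1) * enorm (z - x) ^+ 2).
  exact: sqr_enorm_littleo.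
move=> z; case: (ltP (g z) +oo%E) => [gz|]; last first.
  by rewrite leye_eq => /eqP ->; rewrite addey// leey.
have := xP z; have := descent_ge _ _ _ _ x (z - x) f_diff lipL.
rewrite subrKC /= -(fineK gx) -(fineK (proper_fin_num _ _ _ _ g_proper gz)).
rewrite -!EFinD !lee_fin subrr enorm0 dotv0r dotv0l; lra.
Qed.

Lemma argmin_fix_fb_op (R : realType) (n : nat) (f : 'rV[R]_n -> R)
    (g : 'rV[R]_n -> \bar R) (L gamma : R) :
  (forall x, differentiable f x) -> lipschitz_constants (grad f) L ->
  proper_fun g -> 0 < gamma -> gamma * L <= 1 ->
  argmin (fun x => (f x)%:E + g x)%E `<=` fix_set (fb_op f g gamma).
Proof.
move=> f_diff lipL g_proper gamma0 gammaL x xP; apply/fb_opP => //.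
have gx : g x \is a fin_num.
  apply: (argmin_fin_num _ _ g f _ g_proper) => z.
  by rewrite addeC (addeC (g z)); exact: xP.
move=> z; case: (ltP (g z) +oo%E) => [gz|]; last first.
  by rewrite leye_eq => /eqP ->; rewrite addye// leey.
have := xP z; have := descent_le _ _ _ _ x (z - x) f_diff lipL.
rewrite subrKC /= -(fineK gx) -(fineK (proper_fin_num _ _ _ _ g_proper gz)).
rewrite -!EFinD !lee_fin subrr enorm0 dotv0r.
(* This is where [gamma * L <= 1] enters: the proximal term dominates the descent error. *)
have : L / 2 * enorm (z - x) ^+ 2 <= (2 * gamma)^-1 * enorm (z - x) ^+ 2.
  rewrite ler_wpM2r ?sqr_ge0// invfM mulrC ler_pM2l ?invr_gt0//.
  by rewrite -[leRHS]mul1r ler_pdivlMr// mulrC.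
lra.
Qed.

Theorem proposition3p5 (R : realType) (n : nat)
    (f : 'rV[R]_n -> R) (g : 'rV[R]_n -> \bar R)
    (f_diff : forall x, differentiable f x)
    (f_lip : lipschitz_constants (grad f) !=set0)
    (g_proper : proper_fun g)
    (g_lsc : lower_semicontinuous g)
    (g_prox : prox_bounded g) :
  let phi := fun x => ((f x)%:E + g x)%E in
  let invLf := ((lip_modulus (grad f))%:E^-1)%E in (* +oo if the modulus is 0 *)
  let gamma_g := prox_threshold g in
  let gamma_bar := Order.min gamma_g invLf in
  argmin phi !=set0 ->
  (forall gamma : R, 0 < gamma -> (gamma%:E < gamma_g)%E ->
     fix_set (fb_op f g gamma) `<=` zer (regular_subdiff phi)) /\
  ((forall x, argmin phi x -> (gamma_bar <= crit_threshold f g x)%E) /\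
   (forall gamma : R, 0 < gamma -> (gamma%:E < gamma_bar)%E ->
     argmin phi `<=` fix_set (fb_op f g gamma)) /\
   (forall gamma : R, gamma%:E = invLf -> (invLf < gamma_g)%E ->
     argmin phi `<=` fix_set (fb_op f g gamma))).
Proof.
move=> phi invLf gamma_g gamma_bar _.
pose L := lip_modulus (grad f).
have lipL : lipschitz_constants (grad f) L := lip_modulus_mem _ _ _ _ f_lip.
have L0 : 0 <= L by case: lipL.
(* The non-strict bound covers both the open range of step sizes and the endpoint [invLf]. *)
have fixP gamma : 0 < gamma -> (gamma%:E <= invLf)%E ->
    argmin phi `<=` fix_set (fb_op f g gamma).
  move=> gamma0 gammaL; apply: (argmin_fix_fb_op _ _ _ _ L) => //.
  move: gammaL; rewrite /invLf -/L inver; case: eqVneq => [->|Ln0 gammaL].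
    by rewrite mulr0.
  by rewrite -ler_pdivlMr ?mul1r// lt0r Ln0.
split=> [gamma gamma0 _|]; first exact: fix_fb_op_zer.
split=> [x xP|].
  apply: (@le_trans _ _ invLf); first by rewrite ge_min lexx orbT.
  have ge gamma : 0 < gamma -> (gamma%:E <= invLf)%E ->
      (gamma%:E <= crit_threshold f g x)%E.
    move=> gamma0 gammaL; apply: ereal_sup_ubound; exists gamma => //.
    by left; split => //; exact: fixP.
  (* If [L] is nonzero, the step size [L^-1] itself is admissible. If [L = 0], every positive real
     is, which forces the threshold to be [+oo]. *)
  move: ge; rewrite /invLf -/L inver; case: eqVneq => [_ ge|Ln0]; last first.
    by apply => //; rewrite invr_gt0 lt0r Ln0.
  rewrite leye_eq; apply/eqP/eqyP => gamma gamma0; apply: ge => //.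
  exact: leey.
split=> gamma => [gamma0|gammaE _].
  by rewrite lt_min => /andP[_ /ltW]; exact: fixP.
apply: fixP; last by rewrite gammaE.
(* A real [gamma] cannot equal [+oo], so [L] is nonzero and [gamma = L^-1] is positive. *)
move: gammaE; rewrite /invLf -/L inver; case: eqVneq => // Ln0 [->].
by rewrite invr_gt0 lt0r Ln0.
Qed.
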